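(* The category $\mathbf{Eseq}$ is a coreflective subcategory of $\mathbf{E}$. The coreflector $\sigma:\mathbf{E}\to\mathbf{Eseq}$ sends an exterior space $X=(X,\varepsilon\subset\tau)$ to the e-sequential exterior space $\sigma X=(X,\varepsilon_{seq}\subset\tau_{seq})$ and an exterior map $f$ to $\sigma(f)=f$, and the counit of the coreflection is the identity function $\sigma X\to X$.
   Context: An externology on a topological space $(X,\tau)$ is a nonempty family $\varepsilon\subset\tau$ closed under finite intersections and such that $U\in\tau$, $E\in\varepsilon$, $U\supset E$ imply $U\in\varepsilon$ (possibly $\emptyset\in\varepsilon$). An exterior space $(X,\varepsilon\subset\tau)$ is a topological space with an externology; members of $\varepsilon$ are called e-open. An exterior map is a continuous map such that preimages of e-open sets are e-open. $\mathbf{E}$ is the category of exterior spaces and exterior maps. An exterior sequence in $X$ is a sequence $s:\mathbb{N}\to X$ that is eventually in every e-open set. A subset $U$ is sequentially open if every sequence converging to a point of $U$ is eventually in $U$; a space is sequential if sequentially open subsets are open. A subset of an exterior space is sequentially e-open if it is sequentially open and every exterior sequence is eventually in it. $\tau_{seq}$ is the topology of all sequentially open subsets of $X$, and $\varepsilon_{seq}$ is the family of all sequentially e-open subsets of $X$. An exterior space is e-sequential if it is a sequential topological space and every sequentially e-open subset is e-open. $\mathbf{Eseq}$ is the full subcategory of $\mathbf{E}$ of e-sequential exterior spaces. A full subcategory is coreflective if its inclusion functor has a right adjoint (the coreflector). *)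

(* Defs.v *)
From HB Require Import structures.
From mathcomp Require Import all_boot.
From mathcomp Require Import boolp classical_sets functions filter topology.

Set Implicit Arguments.
Unset Strict Implicit.
Unset Printing Implicit Defensive.

Local Open Scope classical_set_scope.

(* Categories, with morphisms compared by Leibniz equality. *)

Record category := Category {
  obj :> Type ;
  hom : obj -> obj -> Type ;
  idc : forall X, hom X X ;
  compc : forall X Y Z, hom Y Z -> hom X Y -> hom X Z ;
  compc1 : forall X Y (f : hom X Y), compc f (idc X) = f ;
  comp1c : forall X Y (f : hom X Y), compc (idc Y) f = f ;
  compcA : forall X Y Z W (h : hom Z W) (g : hom Y Z) (f : hom X Y),
    compc h (compc g f) = compc (compc h g) f }.

Arguments hom : clear implicits.
Arguments idc {c} X.

Definition functor_laws (C D : category) (F0 : C -> D)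
    (F1 : forall X Y : C, hom C X Y -> hom D (F0 X) (F0 Y)) : Prop :=
  (forall X : C, F1 X X (idc X) = idc (F0 X)) /\
  (forall (X Y Z : C) (g : hom C Y Z) (f : hom C X Y),
    F1 X Z (compc g f) = compc (F1 Y Z g) (F1 X Y f)).

Record functor (C D : category) := Functor {
  fobj :> C -> D ;
  fmap : forall X Y : C, hom C X Y -> hom D (fobj X) (fobj Y) ;
  fmap_laws : functor_laws fmap }.

Arguments Functor {C D fobj fmap} fmap_laws.
Arguments fmap {C D} f {X Y} _.

Lemma functor_id_laws (C : category) :
  @functor_laws C C (fun X => X) (fun X Y f => f).
Proof. by []. Qed.

Definition functor_id (C : category) : functor C C :=
  Functor (functor_id_laws C).

Lemma functor_comp_laws (C D B : category)
    (G : functor D B) (F : functor C D) :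
  @functor_laws C B (fun X => G (F X)) (fun X Y f => fmap G (fmap F f)).
Proof.
case: (fmap_laws F) (fmap_laws G) => F_id F_comp [G_id G_comp].
by split=> [X|X Y Z g f]; rewrite ?F_id ?G_id ?F_comp ?G_comp.
Qed.

Definition functor_comp (C D B : category)
    (G : functor D B) (F : functor C D) : functor C B :=
  Functor (functor_comp_laws G F).

Record nat_trans (C D : category) (F G : functor C D) := NatTrans {
  component :> forall X : C, hom D (F X) (G X) ;
  naturality : forall (X Y : C) (f : hom C X Y),
    compc (component Y) (fmap F f) = compc (fmap G f) (component X) }.

(* F is left adjoint to G, with unit eta and counit eps. *)
Definition adjunction (C D : category) (F : functor C D) (G : functor D C)
    (eta : nat_trans (functor_id C) (functor_comp G F))
    (eps : nat_trans (functor_comp F G) (functor_id D)) : Prop :=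
  (forall X : C, compc (eps (F X)) (fmap F (eta X)) = idc (F X)) /\
  (forall Y : D, compc (fmap G (eps Y)) (eta (G Y)) = idc (G Y)).

Definition full_subcategory (C : category) (P : C -> Prop) : category :=
  @Category {X : C | P X} (fun X Y => hom C (sval X) (sval Y))
    (fun X => idc (sval X)) (fun X Y Z g f => compc g f)
    (fun X Y f => compc1 f) (fun X Y f => comp1c f)
    (fun X Y Z W h g f => compcA h g f).

Lemma inclusion_laws (C : category) (P : C -> Prop) :
  @functor_laws (full_subcategory P) C (fun X => sval X) (fun X Y f => f).
Proof. by []. Qed.

Definition inclusion (C : category) (P : C -> Prop) :
    functor (full_subcategory P) C :=
  Functor (inclusion_laws P).

Definition is_coreflector (C : category) (P : C -> Prop)
    (G : functor C (full_subcategory P))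
    (eps : nat_trans (functor_comp (inclusion P) G) (functor_id C)) : Prop :=
  exists eta : nat_trans (functor_id (full_subcategory P))
                         (functor_comp G (inclusion P)),
    adjunction eta eps.

Definition coreflective (C : category) (P : C -> Prop) : Prop :=
  exists (G : functor C (full_subcategory P))
         (eps : nat_trans (functor_comp (inclusion P) G) (functor_id C)),
    is_coreflector eps.

(* Exterior spaces. Nonemptiness together with closure under binary
   intersections and open supersets gives closure under all finite
   intersections: the empty one, the whole space, is an open superset. *)

HB.mixin Record isExterior T & Topological T := {
  eopen : set_system T ;
  eopen_open : forall E : set T, eopen E -> open E ;
  eopen_nonempty : eopen !=set0 ;
  eopenI : forall E F : set T, eopen E -> eopen F -> eopen (E `&` F) ;
  eopenS : forall E U : set T, eopen E -> open U -> E `<=` U -> eopen U }.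

#[short(type="exteriorType")]
HB.structure Definition Exterior := {T of isExterior T & Topological T}.

Definition exterior_map (X Y : exteriorType) (f : X -> Y) : Prop :=
  continuous f /\ (forall E : set Y, eopen E -> eopen (f @^-1` E)).

Record exterior_hom (X Y : exteriorType) := ExteriorHom {
  ext_fun : X -> Y ;
  ext_funP : exterior_map ext_fun }.

Arguments ExteriorHom {X Y ext_fun} ext_funP.

Lemma exterior_hom_eq (X Y : exteriorType) (f g : exterior_hom X Y) :
  ext_fun f = ext_fun g -> f = g.
Proof.
case: f g => f Pf [g Pg] /= fg; case: g / fg Pg => Pg.
by rewrite (Prop_irrelevance Pf Pg).
Qed.

Lemma exterior_map_id (X : exteriorType) : exterior_map (fun x : X => x).
Proof. by split=> // x; exact: cvg_id. Qed.

Lemma exterior_map_comp (X Y Z : exteriorType) (g : exterior_hom Y Z)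
    (f : exterior_hom X Y) : exterior_map (ext_fun g \o ext_fun f).
Proof.
case: f g => f [fc fe] [g [gc ge]] /=; split=> [x|E /ge/fe //].
exact: continuous_comp (fc x) (gc (f x)).
Qed.

Definition exterior_comp (X Y Z : exteriorType) (g : exterior_hom Y Z)
    (f : exterior_hom X Y) : exterior_hom X Z :=
  ExteriorHom (exterior_map_comp g f).

Definition E_category : category.
Proof.
refine (@Category exteriorType exterior_hom
  (fun X => ExteriorHom (exterior_map_id X)) exterior_comp _ _ _).
- by move=> X Y f; exact: exterior_hom_eq.
- by move=> X Y f; exact: exterior_hom_eq.
- by move=> X Y Z W h g f; exact: exterior_hom_eq.
Defined.

Definition exterior_sequence (X : exteriorType) (s : nat -> X) : Prop :=
  forall E : set X, eopen E -> \forall n \near \oo, E (s n).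

Definition seq_open (X : topologicalType) (U : set X) : Prop :=
  forall (s : nat -> X) (x : X), U x -> s n @[n --> \oo] --> x ->
    \forall n \near \oo, U (s n).

Definition sequential (X : topologicalType) : Prop :=
  forall U : set X, seq_open U -> open U.

Definition seq_eopen (X : exteriorType) (U : set X) : Prop :=
  seq_open U /\
  (forall s : nat -> X, exterior_sequence s -> \forall n \near \oo, U (s n)).

Definition e_sequential (X : exteriorType) : Prop :=
  sequential X /\ (forall U : set X, seq_eopen U -> eopen U).

Definition Eseq_category : category :=
  full_subcategory (e_sequential : E_category -> Prop).

(* The carrier of X, to be equipped with the topology of sequentially open
   subsets and the externology of sequentially e-open subsets. *)
Definition seq_space (X : exteriorType) : Type := X.

Section SeqSpace.
Variable X : exteriorType.

Lemma seq_openT : seq_open [set: X].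
Proof. by move=> s x _ _; exact: nearW. Qed.

Lemma seq_openI : setI_closed (@seq_open X).
Proof.
by move=> U V oU oV s x [Ux Vx] sx; apply: filterI; [exact: oU sx|exact: oV sx].
Qed.

Lemma seq_open_bigcup (I : Type) (U : I -> set X) :
  (forall i, seq_open (U i)) -> seq_open (\bigcup_i U i).
Proof.
move=> oU s x [i _ Uix] sx; apply: filterS (oU i s x Uix sx) => n Un.
by exists i.
Qed.

HB.instance Definition _ := Choice.copy (seq_space X) X.
HB.instance Definition _ := isOpenTopological.Build (seq_space X)
  seq_openT seq_openI seq_open_bigcup.

Lemma seq_eopen_nonempty : @seq_eopen X !=set0.
Proof. by exists setT; split=> [|s _]; [exact: seq_openT|exact: nearW]. Qed.

Lemma seq_eopenI (E F : set X) :
  seq_eopen E -> seq_eopen F -> seq_eopen (E `&` F).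
Proof.
move=> [oE eE] [oF eF]; split=> [|s es]; first exact: seq_openI.
by apply: filterI; [exact: eE|exact: eF].
Qed.

Lemma seq_eopenS (E U : set X) :
  seq_eopen E -> seq_open U -> E `<=` U -> seq_eopen U.
Proof.
by move=> [_ eE] oU EU; split=> // s es; apply: filterS (eE s es) => n /EU.
Qed.

HB.instance Definition _ := isExterior.Build (seq_space X)
  (fun (E : set X) (h : seq_eopen E) => proj1 h)
  seq_eopen_nonempty seq_eopenI seq_eopenS.

End SeqSpace.

Definition sigma (X : exteriorType) : exteriorType := seq_space X.

Lemma open_sigmaE (X : exteriorType) : @open (sigma X) = @seq_open X.
Proof. by []. Qed.

Lemma eopen_sigmaE (X : exteriorType) : @eopen (sigma X) = @seq_eopen X.
Proof. by []. Qed.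

(* Main.v *)
Require Import Defs.
From mathcomp Require Import all_boot.
From mathcomp Require Import boolp classical_sets functions filter topology.

Set Implicit Arguments.
Unset Strict Implicit.
Unset Printing Implicit Defensive.

Local Open Scope classical_set_scope.

(** Passing from X to sigma X changes neither the convergent sequences
    ([cvg_sigma]) nor the exterior sequences ([exterior_sequence_sigma]):
    the sets added to the topology and to the externology are precisely those
    that these sequences cannot detect as new.  Being e-sequential is a
    condition on these two classes of sequences only, hence sigma X is
    e-sequential.  A function out of an e-sequential space is exterior as soon
    as it preserves both classes ([exterior_map_of_sequences]), whatever its
    codomain.  This gives at once that an exterior map X -> Y is exterior as a
    map sigma X -> sigma Y, and that the identity A -> sigma A is exterior when
    A is e-sequential.  The latter is the unit and the identity sigma X -> X is
    the counit; since every function involved is an identity or the given map,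
    naturality and the triangle identities hold on underlying functions. *)

Lemma open_seq_open (X : topologicalType) (U : set X) : open U -> seq_open U.
Proof. by move=> oU s x Ux; apply; exact: open_nbhs_nbhs. Qed.

Lemma eopen_seq_eopen (X : exteriorType) (E : set X) : eopen E -> seq_eopen E.
Proof.
by move=> eE; split=> [|s]; [exact/open_seq_open/eopen_open|exact].
Qed.

Lemma exterior_map_counit (X : exteriorType) :
  @exterior_map (sigma X) X (fun x => x).
Proof.
split; last exact: eopen_seq_eopen.
apply/continuousP => U oU.
by rewrite open_sigmaE; exact: open_seq_open.
Qed.

(** In the direction from X to sigma X, a neighbourhood in sigma X contains a
    sequentially open set around the limit, which captures the sequence by
    definition. *)
Lemma cvg_sigma (X : exteriorType) (s : nat -> X) (x : X) :
  (s n : sigma X) @[n --> \oo] --> (x : sigma X) <-> s n @[n --> \oo] --> x.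
Proof.
split=> [sx|sx A].
  exact: cvg_comp sx (proj1 (exterior_map_counit X) x).
rewrite nbhsE => -[U [oU Ux] UA].
rewrite open_sigmaE in oU.
by apply: filterS (oU s x Ux sx) => n /UA.
Qed.

Lemma exterior_sequence_sigma (X : exteriorType) (s : nat -> X) :
  @exterior_sequence (sigma X) s <-> exterior_sequence s.
Proof.
split=> es E; first by move=> /eopen_seq_eopen; exact: es.
by rewrite eopen_sigmaE => -[_]; exact.
Qed.

Lemma e_sequential_sigma (X : exteriorType) : e_sequential (sigma X).
Proof.
have sigma_seq_open (U : set X) : @seq_open (sigma X) U -> seq_open U.
  by move=> oU s x Ux /cvg_sigma; exact: oU.
split=> U; first by rewrite open_sigmaE; exact: sigma_seq_open.
rewrite eopen_sigmaE => -[oU eU]; split; first exact: sigma_seq_open.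
by move=> s /exterior_sequence_sigma; exact: eU.
Qed.

(** Preimages of open and e-open sets under such a function are sequentially
    open and sequentially e-open, and the domain has no other such sets than
    its open and e-open ones. *)
Lemma exterior_map_of_sequences (X Y : exteriorType) (f : X -> Y) :
    e_sequential X ->
    (forall (s : nat -> X) (x : X),
      s n @[n --> \oo] --> x -> f (s n) @[n --> \oo] --> f x) ->
    (forall s : nat -> X, exterior_sequence s -> exterior_sequence (f \o s)) ->
  exterior_map f.
Proof.
move=> [seqX eseqX] fcvg fext.
have f_seq_open (V : set Y) : open V -> seq_open (f @^-1` V).
  by move=> /open_seq_open oV s x Vfx /fcvg; exact: oV.
split; first by apply/continuousP => V /f_seq_open; exact: seqX.
move=> E eE; apply: eseqX; split; first exact/f_seq_open/eopen_open.
by move=> s /fext; exact.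
Qed.

Lemma exterior_sequence_comp (X Y : exteriorType) (f : X -> Y) (s : nat -> X) :
  exterior_map f -> exterior_sequence s -> exterior_sequence (f \o s).
Proof. by move=> [_ fe] es E /fe; exact: es. Qed.

Lemma exterior_map_sigma (X Y : exteriorType) (f : exterior_hom X Y) :
  @exterior_map (sigma X) (sigma Y) (ext_fun f).
Proof.
have fP := ext_funP f.
apply: exterior_map_of_sequences; first exact: e_sequential_sigma.
  by move=> s x /cvg_sigma sx; apply/cvg_sigma; exact: cvg_comp sx (proj1 fP x).
move=> s /exterior_sequence_sigma es; apply/exterior_sequence_sigma.
exact: exterior_sequence_comp fP es.
Qed.

Lemma exterior_map_unit (X : exteriorType) :
  e_sequential X -> @exterior_map X (sigma X) (fun x => x).
Proof.
move=> /exterior_map_of_sequences; apply=> [s x /cvg_sigma //|s es].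
exact/exterior_sequence_sigma.
Qed.

Lemma sigma_functor_laws : @functor_laws E_category Eseq_category
  (fun X : exteriorType => exist _ (sigma X) (e_sequential_sigma X))
  (fun (X Y : exteriorType) (f : exterior_hom X Y) =>
     ExteriorHom (exterior_map_sigma f)).
Proof. by split=> *; exact: exterior_hom_eq. Qed.

Definition sigma_functor : functor E_category Eseq_category :=
  Functor sigma_functor_laws.

Definition sigma_counit : nat_trans
  (functor_comp (inclusion (e_sequential : E_category -> Prop)) sigma_functor)
  (functor_id E_category).
Proof.
refine (@NatTrans _ _
  (functor_comp (inclusion (e_sequential : E_category -> Prop)) sigma_functor)
  (functor_id E_category)
  (fun X : exteriorType => ExteriorHom (exterior_map_counit X)) _).
by move=> X Y f; exact: exterior_hom_eq.
Defined.

Definition sigma_unit : nat_trans (functor_id Eseq_category)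
  (functor_comp sigma_functor (inclusion (e_sequential : E_category -> Prop))).
Proof.
refine (@NatTrans _ _ (functor_id Eseq_category)
  (functor_comp sigma_functor (inclusion (e_sequential : E_category -> Prop)))
  (fun X : Eseq_category => ExteriorHom (exterior_map_unit (svalP X))) _).
by move=> X Y f; exact: exterior_hom_eq.
Defined.

Lemma sigma_is_coreflector : is_coreflector sigma_counit.
Proof. by exists sigma_unit; split=> X; exact: exterior_hom_eq. Qed.

Theorem mainTheorem6 :
  coreflective (e_sequential : E_category -> Prop) /\
  exists (sigma_eseq : forall X : exteriorType, e_sequential (sigma X))
         (sigma_ext : forall (X Y : exteriorType) (f : exterior_hom X Y),
            @exterior_map (sigma X) (sigma Y) (ext_fun f))
         (sigma_laws : @functor_laws E_category Eseq_category
            (fun X : exteriorType => exist _ (sigma X) (sigma_eseq X))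
            (fun (X Y : exteriorType) (f : exterior_hom X Y) =>
               ExteriorHom (sigma_ext X Y f)))
         (eps : nat_trans
            (functor_comp (inclusion (e_sequential : E_category -> Prop))
                          (Functor sigma_laws))
            (functor_id E_category)),
    is_coreflector eps /\
    forall X : exteriorType,
      @ext_fun (sigma X) X (eps X) = (fun x : X => x).
Proof.
split; first by exists sigma_functor, sigma_counit; exact: sigma_is_coreflector.
exists e_sequential_sigma, exterior_map_sigma, sigma_functor_laws, sigma_counit.
by split; first exact: sigma_is_coreflector.
Qed.
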